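(* Let $\kappa\ge 1$ be an integer, $m=2\kappa-1$, $n=m+1=2\kappa$, and let $a(z)=\sum_{j=-\kappa}^{\kappa}a_jz^j$ be a Laurent polynomial with real coefficients such that $\widehat a(z)=z^{\kappa}a(z)$ is a polynomial of degree $n$ which is relatively prime with $\widehat a(-z)$. Let $\mathcal H^-,\mathcal H^+\in\mathbb R^{n\times n}$ be the matrices with entries $$(\mathcal H^-)_{r,c}=a_{-\kappa+2r-c},\qquad (\mathcal H^+)_{r,c}=a_{-\kappa+2r-1-c},\qquad 1\le r,c\le n,$$ where $a_j=0$ for $|j|>\kappa$. Then $\mathcal H^-$ and $\mathcal H^+$ are invertible. Moreover, for each $\star\in\{+,-\}$ and each $1\le i\le n$, the polynomial $p_i^\star(z)=\sum_{c=1}^{n}\big((\mathcal H^\star)^{-1}\big)_{c,i}\,z^{c-1}$, whose coefficients are the entries of the $i$-th column of $(\mathcal H^\star)^{-1}$, is the unique polynomial of degree less than $n$ such that $$\widehat a(z)\,p_i^\star(z)\ \star\ \widehat a(-z)\,p_i^\star(-z)=2\,z^{2i-\ell^\star},$$ where $\ell^{+}=2$ and $\ell^{-}=1$.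
   Context: For $\star\in\{+,-\}$, the expression $A\star B$ means $A+B$ if $\star=+$ and $A-B$ if $\star=-$. Explicitly, the first row of $\mathcal H^-$ is $(a_{-\kappa+1},a_{-\kappa},0,\dots)$, its second row is $(a_{-\kappa+3},a_{-\kappa+2},a_{-\kappa+1},a_{-\kappa},0,\dots)$, and so on; the first row of $\mathcal H^+$ is $(a_{-\kappa},0,\dots)$, its second row is $(a_{-\kappa+2},a_{-\kappa+1},a_{-\kappa},0,\dots)$, and so on. *)

(* Defs.v *)
From mathcomp Require Import all_boot all_order all_algebra.
From mathcomp Require Import reals.

Set Implicit Arguments.
Unset Strict Implicit.
Unset Printing Implicit Defensive.

Import Order.TTheory GRing.Theory Num.Theory.
Local Open Scope ring_scope.

Inductive sign := Plus | Minus.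

Definition star (V : zmodType) (s : sign) (A B : V) : V :=
  match s with Plus => A + B | Minus => A - B end.

Definition ell (s : sign) : nat :=
  match s with Plus => 2 | Minus => 1 end.

Section Definitions.
Variable R : realType.

(* A Laurent polynomial is given by its coefficient family [a : int -> R]; the
   requirement that [a] vanishes outside [-k, k] is [laurent_support]. *)
Definition laurent_support (k : nat) (a : int -> R) : Prop :=
  forall j : int, k%:Z < `|j| -> a j = 0.

(* z^k a(z) as a genuine polynomial: the coefficient of z^i is a_(i - k);
   see [ahat_horner]. *)
Definition ahat (k : nat) (a : int -> R) : {poly R} :=
  \poly_(i < (2 * k).+1) a (i%:Z - k%:Z).

Lemma ahat_horner (k : nat) (a : int -> R) (x : R) : x != 0 ->
  (ahat k a).[x]
  = x ^+ k * \sum_(i < (2 * k).+1) a (i%:Z - k%:Z) * x ^ (i%:Z - k%:Z).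
Proof.
move=> x0; rewrite horner_poly mulr_sumr; apply: eq_bigr => i _.
by rewrite mulrCA [x ^+ k]exprnP -expfzDr // addrCA subrr addr0 -exprnP.
Qed.

Definition reflect_poly (p : {poly R}) : {poly R} := p \Po (- 'X).

(* Ordinals start at 0, so the 1-based row and column indices of the usual
   formulas a_(-k+2r-c) and a_(-k+2r-1-c) are [r.+1] and [c.+1]. *)
Definition Hminus (k n : nat) (a : int -> R) : 'M[R]_n :=
  \matrix_(r < n, c < n) a (- k%:Z + 2 * (r.+1)%:Z - (c.+1)%:Z).

Definition Hplus (k n : nat) (a : int -> R) : 'M[R]_n :=
  \matrix_(r < n, c < n) a (- k%:Z + 2 * (r.+1)%:Z - 1 - (c.+1)%:Z).

Definition Hstar (s : sign) (k n : nat) (a : int -> R) : 'M[R]_n :=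
  match s with Plus => Hplus k n a | Minus => Hminus k n a end.

Definition col_poly (n : nat) (M : 'M[R]_n) (i : 'I_n) : {poly R} :=
  \sum_(c < n) M c i *: 'X^c.

End Definitions.

(* Main.v *)
Require Import Defs.
From mathcomp Require Import all_boot all_order all_algebra.
From mathcomp Require Import reals.
From mathcomp Require Import zify.

Set Implicit Arguments.
Unset Strict Implicit.
Unset Printing Implicit Defensive.

Import Order.TTheory GRing.Theory Num.Theory.
Local Open Scope ring_scope.

(** For a polynomial [q], the combination [star s q (reflect_poly q)] doubles
    the coefficients of [q] at the exponents of one parity and kills the
    others; the surviving exponents are exactly the [2 * r.+1 - ell s].  Apply
    this to [q = ahat * p] with [size p <= n].  Row [r] of [Hstar s] lists the
    coefficients that compute the convolution [ahat * p] at the exponent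
    [2 * r.+1 - ell s], and since [q] has degree less than [2 * n] the [n] rows
    see every surviving coefficient.  Hence the combination is twice the
    polynomial carrying the vector [Hstar s *m p] on these exponents
    ([star_HstarE]).

    If [Hstar s *m p = 0], then [ahat] divides [reflect_poly ahat *
    reflect_poly p], so by coprimality it divides [reflect_poly p]; as [p] has
    smaller degree than [ahat], it is zero ([coprime_star_reflect_eq0]).  The
    matrices are therefore invertible.  The right-hand side
    [2 *: 'X^(2 * i.+1 - ell s)] corresponds to the [i]-th unit vector, so
    the functional equation says that [Hstar s *m p] is that unit vector, i.e.
    that [p] is the [i]-th column of the inverse ([star_monomialP]). *)

Section Reflection.
Variable R : realType.
Implicit Types p q : {poly R}.

Lemma coef_reflect p j : (reflect_poly p)`_j = (-1) ^+ j * p`_j.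
Proof.
rewrite /reflect_poly comp_polyE coef_sum.
under eq_bigr => i _ do rewrite exprNn -polyC1 -polyCN -polyC_exp coefZ coefCM coefXn.
have [jlt|jge] := ltnP j (size p).
  rewrite (bigD1 (Ordinal jlt)) //= eqxx mulr1 mulrC big1 ?addr0 // => i ij.
  rewrite [j == i]eq_sym; case: eqP => [e|_]; last by rewrite !mulr0.
  by case/eqP: ij; apply: val_inj.
rewrite [p`_j]nth_default // mulr0 big1 // => i _.
by rewrite gtn_eqF ?mulr0 // (leq_trans (ltn_ord i)).
Qed.

Lemma reflect_polyM p q :
  reflect_poly (p * q) = reflect_poly p * reflect_poly q.
Proof. exact: comp_polyM. Qed.

Lemma size_reflect p : size (reflect_poly p) = size p.
Proof. by rewrite size_comp_poly2 // size_polyN size_polyX. Qed.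

Lemma reflect_poly_eq0 p : (reflect_poly p == 0) = (p == 0).
Proof. by rewrite -!size_poly_eq0 size_reflect. Qed.

(** The exponents that survive are those with the parity of [ell s]: even for
    [Plus], odd for [Minus]. *)
Lemma coef_star_reflect s q j :
  (star s q (reflect_poly q))`_j = (q`_j *+ 2) *+ (odd j == odd (ell s)).
Proof.
case: s => /=; rewrite ?coefB ?coefD coef_reflect -signr_odd;
by case: (odd j) => /=; rewrite ?mulr0n ?mulr1n ?mulr2n ?expr1 ?expr0;
  rewrite ?mulN1r ?mul1r ?subrr ?opprK.
Qed.

(** Coprimality forces the divisibility of [reflect_poly p] by [f], which the
    degree bound then excludes unless [p] vanishes. *)
Lemma coprime_star_reflect_eq0 s f p :
  coprimep f (reflect_poly f) -> (size p < size f)%N ->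
  star s (f * p) (reflect_poly f * reflect_poly p) = 0 -> p = 0.
Proof.
move=> cop szp eq0.
have dv : f %| reflect_poly f * reflect_poly p.
  case: s eq0 => /= [/eqP|/eqP]; first rewrite addrC addr_eq0 => /eqP ->.
    by rewrite -mulrN dvdp_mulIl.
  by rewrite subr_eq0 => /eqP <-; rewrite dvdp_mulIl.
rewrite Gauss_dvdpr // in dv.
apply/eqP; rewrite -reflect_poly_eq0; apply: contraLR szp => rp0.
by rewrite -leqNgt -(size_reflect p) dvdp_leq.
Qed.

End Reflection.

Section Sampling.
Variable R : realType.

(** The exponents [2 * r.+1 - ell s] are [2 * r] for [Plus] and [2 * r + 1] for
    [Minus], so this spreads a vector over the [n] lowest exponents of the
    parity selected by [s]. *)
Definition parity_poly (s : sign) n (v : 'cV[R]_n) : {poly R} :=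
  \sum_(r < n) v r 0 *: 'X^(2 * r.+1 - ell s).

Lemma parity_exponent s j :
  odd j = odd (ell s) -> exists t, j = (2 * t.+1 - ell s)%N.
Proof.
move=> e; exists j./2; have := odd_double_half j.
by rewrite e; case: s {e} => /=; lia.
Qed.

Lemma odd_parity_exponent s t : odd (2 * t.+1 - ell s) = odd (ell s).
Proof. by case: s => /=; lia. Qed.

Lemma parity_exponent_inj s t u :
  (2 * t.+1 - ell s == 2 * u.+1 - ell s)%N = (t == u).
Proof. by case: s => /=; lia. Qed.

Lemma coef_parity_poly s n (v : 'cV[R]_n) (r : 'I_n) :
  (parity_poly s v)`_(2 * r.+1 - ell s) = v r 0.
Proof.
rewrite coef_sum (bigD1 r) //= coefZ coefXn eqxx mulr1 big1 ?addr0 // => i.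
rewrite -val_eqE eq_sym => /negPf ir.
by rewrite coefZ coefXn parity_exponent_inj ir mulr0.
Qed.

Lemma parity_poly_inj s n : injective (@parity_poly s n).
Proof.
move=> v w vw; apply/matrixP => r c.
by rewrite ord1 -(coef_parity_poly s) vw coef_parity_poly.
Qed.

Lemma parity_poly0 s n : @parity_poly s n 0 = 0.
Proof. by apply: big1 => r _; rewrite mxE scale0r. Qed.

Lemma parity_poly_delta s n (i : 'I_n) :
  parity_poly s (delta_mx i 0) = 'X^(2 * i.+1 - ell s).
Proof.
rewrite /parity_poly (bigD1 i) //= mxE !eqxx scale1r big1 ?addr0 // => r ri.
by rewrite mxE (negPf ri) scale0r.
Qed.

(** The bound [2 * n] is what makes [n] samples enough: the first exponent of
    the right parity beyond the samples is at least [2 * n]. *)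
Lemma star_reflect_parity_poly s n (q : {poly R}) :
  (size q <= 2 * n)%N ->
  star s q (reflect_poly q)
  = 2%:R *: parity_poly s (\col_(r < n) q`_(2 * r.+1 - ell s)).
Proof.
move=> szq; apply/polyP => j; rewrite coef_star_reflect coefZ.
have [/parity_exponent[t ->]|/eqP od] := odd j =P odd (ell s).
  rewrite mulr1n -[LHS]mulr_natl; congr (_ * _).
  have [tn|nt] := ltnP t n.
    by rewrite (coef_parity_poly s _ (Ordinal tn)) mxE.
  rewrite nth_default; last by apply: leq_trans szq _; case: (s) => /=; lia.
  rewrite coef_sum big1 // => r _.
  by rewrite coefZ coefXn parity_exponent_inj gtn_eqF ?mulr0 // (leq_trans _ nt).
rewrite mulr0n coef_sum big1 ?mulr0 // => r _; rewrite coefZ coefXn.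
case: eqP => [e|_]; last by rewrite mulr0.
by rewrite e odd_parity_exponent eqxx in od.
Qed.

End Sampling.

Section Hurwitz.
Variables (R : realType) (k n : nat) (a : int -> R).
Hypothesis ha : laurent_support k a.

(** The support condition is what makes this hold also outside the range of the
    coefficients of [ahat]: for [j < c] the index on the left is below [- k],
    and for [j - c > 2 * k] it is above [k]. *)
Lemma laurent_coef_shift (j c : nat) :
  a (j%:Z - c%:Z - k%:Z) = (ahat k a * 'X^c)`_j.
Proof.
rewrite coefMXn; case: ltnP => jc; first by rewrite ha //; lia.
rewrite coef_poly subzn //; case: ltnP => // lt.
by rewrite ha //; lia.
Qed.

(** Reading both matrices through shifts of [ahat] makes their rows convolution
    formulas and treats the two signs at once. *)
Lemma HstarE s (r c : 'I_n) :
  Hstar s k n a r c = (ahat k a * 'X^c)`_(2 * r.+1 - ell s).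
Proof.
by rewrite -laurent_coef_shift; case: s; rewrite mxE /=; congr (a _); lia.
Qed.

Lemma Hstar_mulE s (p : {poly R}) : (size p <= n)%N ->
  Hstar s k n a *m (poly_rV p)^T
  = \col_(r < n) (ahat k a * p)`_(2 * r.+1 - ell s).
Proof.
move=> szp; apply/matrixP => r j; rewrite !mxE.
have -> : p = \sum_(c < n) p`_c *: 'X^c.
  rewrite -poly_def; apply/polyP => i; rewrite coef_poly.
  by case: ltnP => // ni; rewrite nth_default // (leq_trans szp).
rewrite mulr_sumr coef_sum; apply: eq_bigr => c _.
rewrite HstarE !mxE -scalerAr coefZ mulrC; congr (_ * _).
by rewrite -poly_def coef_poly ltn_ord.
Qed.

Hypothesis hdeg : size (ahat k a) = n.+1.

(** The bridge between the functional equation and linear algebra: the left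
    side has degree less than [2 * n], hence is determined by the samples that
    [Hstar] computes. *)
Lemma star_HstarE s (p : {poly R}) : (size p <= n)%N ->
  star s (ahat k a * p) (reflect_poly (ahat k a) * reflect_poly p)
  = 2%:R *: parity_poly s (Hstar s k n a *m (poly_rV p)^T).
Proof.
move=> szp; rewrite -reflect_polyM Hstar_mulE // -star_reflect_parity_poly //.
have := size_polyMleq (ahat k a) p; rewrite hdeg; lia.
Qed.

Hypothesis hcop : coprimep (ahat k a) (reflect_poly (ahat k a)).

(** A vector in the kernel is the coefficient vector of a polynomial that makes
    the combination of [coprime_star_reflect_eq0] vanish.  The kernel criterion
    [inj_row_free] acts on row vectors, whence the transposes. *)
Lemma Hstar_unit s : Hstar s k n a \in unitmx.
Proof.
rewrite -unitmx_tr -row_free_unit; apply: inj_row_free => v vH0.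
have szv : (size (rVpoly v) <= n)%N by apply: size_poly.
rewrite -[v]rVpolyK.
suff -> : rVpoly v = 0 by rewrite linear0.
apply: (coprime_star_reflect_eq0 hcop (s := s)); first by rewrite hdeg.
rewrite star_HstarE // rVpolyK -[Hstar _ _ _ _]trmxK -trmx_mul vH0 trmx0.
by rewrite parity_poly0 scaler0.
Qed.

(** By [parity_poly_inj] the equation amounts to the linear system whose
    right-hand side is the [i]-th unit vector. *)
Lemma star_monomialP s (i : 'I_n) (p : {poly R}) : (size p <= n)%N ->
  star s (ahat k a * p) (reflect_poly (ahat k a) * reflect_poly p)
    = 2%:R *: 'X^(2 * i.+1 - ell s)
  <-> (poly_rV p)^T = col i (invmx (Hstar s k n a)).
Proof.
move=> szp; rewrite star_HstarE // -parity_poly_delta colE; split=> [eq2|->].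
  have two_neq0 : (2%:R : R) != 0 by rewrite pnatr_eq0.
  by rewrite -(parity_poly_inj (scalerI two_neq0 eq2)) mulKmx ?Hstar_unit.
by rewrite mulKVmx ?Hstar_unit.
Qed.

End Hurwitz.

Lemma col_polyE (R : realType) n (M : 'M[R]_n) (i : 'I_n) :
  col_poly M i = rVpoly (col i M)^T.
Proof.
rewrite /rVpoly poly_def; apply: eq_bigr => c _.
by rewrite valK !mxE.
Qed.

Theorem proposition1 (R : realType) (kappa m n : nat) (a : int -> R)
  (hkappa : (1 <= kappa)%N)
  (hm : m = (2 * kappa - 1)%N)
  (hn : n = (m + 1)%N)
  (ha : laurent_support kappa a)
  (hdeg : size (ahat kappa a) = n.+1)
  (hcoprime : coprimep (ahat kappa a) (reflect_poly (ahat kappa a))) :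
  [/\ Hminus kappa n a \in unitmx,
      Hplus kappa n a \in unitmx
    & forall (s : sign) (i : 'I_n),
        unique
          (fun p : {poly R} =>
             (size p <= n)%N /\
             star s (ahat kappa a * p)
                    (reflect_poly (ahat kappa a) * reflect_poly p)
             = 2%:R *: 'X^(2 * i.+1 - ell s))
          (col_poly (invmx (Hstar s kappa n a)) i)].
Proof.
split; [exact: (Hstar_unit ha hdeg hcoprime Minus)
       |exact: (Hstar_unit ha hdeg hcoprime Plus)|move=> s i].
split=> [|p [szp /(star_monomialP ha hdeg hcoprime _ _ szp) pE]].
  have szc : (size (col_poly (invmx (Hstar s kappa n a)) i) <= n)%N.
    by rewrite col_polyE size_poly.
  split=> //; apply/(star_monomialP ha hdeg hcoprime _ _ szc).
  by rewrite col_polyE rVpolyK trmxK.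
by rewrite col_polyE -pE trmxK poly_rV_K.
Qed.
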